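(* For every $l\in\mathbb{N}$ and every strictly increasing sequence $\mathbf{k}=(k_1,\dots,k_l)\in\mathbb{N}^l$ there exist polynomials $Q^{\mathbf{k}}_n(x,y)$, $0\leqslant n\leqslant k_l+1$, such that $$E_{\mathbf{k}}(z,x,y)=E(z,x,y)\sum_{n=0}^{k_l+1} z^n Q^{\mathbf{k}}_n(x,y)$$ for all $z,x,y\in\mathbb{C}$ with $|z|<1$.
   Context: $\mathbb{N}$ is the set of positive integers. $H_n(x)$ denotes the (physicists') Hermite polynomials, $H_n(x)=(-1)^n e^{x^2}\frac{d^n}{dx^n}e^{-x^2}$. The Wronskian is $\mathrm{Wr}[f_1,\dots,f_m]=\det[\partial_x^{i-1}f_j(x)]_{1\leqslant i,j\leqslant m}$. For a strictly increasing sequence $\mathbf{k}=(k_1,\dots,k_l)\in\mathbb{N}^l$ and $n\in\mathbb{Z}_{\geqslant 0}$, $H_{\mathbf{k},n}(x):=\mathrm{Wr}[H_{k_1}(x),\dots,H_{k_l}(x),H_n(x)]$. For $|z|<1$ and $x,y\in\mathbb{C}$, $$E(z,x,y):=\sum_{n\geqslant 0} z^n\frac{H_n(x)H_n(y)}{2^n n!}=\frac{1}{\sqrt{1-z^2}}\exp\Big(\frac{2xyz-z^2(x^2+y^2)}{1-z^2}\Big)$$ (principal branch of the square root), and $$E_{\mathbf{k}}(z,x,y):=\sum_{n\in\mathbb{Z}_{\geqslant 0}\setminus\mathbf{k}} z^n\frac{H_{\mathbf{k},n}(x)H_{\mathbf{k},n}(y)}{2^{n+l}\,n!\,\prod_{j=1}^l(n-k_j)},$$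 where $\mathbb{Z}_{\geqslant 0}\setminus\mathbf{k}$ means the nonnegative integers different from $k_1,\dots,k_l$; this series converges for all $|z|<1$, $x,y\in\mathbb{C}$. *)

(* Defs.v *)
From HB Require Import structures.
From mathcomp Require Import all_boot all_order all_algebra.
From mathcomp Require Import complex.
From mathcomp Require Import all_classical all_reals all_analysis.
From mathcomp Require Import ring.

Set Implicit Arguments.
Unset Strict Implicit.
Unset Printing Implicit Defensive.

Import Order.TTheory GRing.Theory Num.Theory.
Import numFieldNormedType.Exports.

Local Open Scope ring_scope.
Local Open Scope complex_scope.

Definition rodrigues (R : realType) (n : nat) (x : R) : R :=
  (-1) ^+ n * expR (x ^+ 2) * derive1n n (fun t : R => expR (- t ^+ 2)) x.

(* A polynomial is determined by its values on the real line, so there is at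
   most one choice here; [hermiteE] shows that there is one, i.e. that the
   default value 0 is never used. *)
Definition hermite (R : realType) (n : nat) : {poly R} :=
  xget 0 [set p : {poly R} | forall x, p.[x] = rodrigues n x]%classic.

Lemma rodrigues_poly (R : realType) (n : nat) :
  exists p : {poly R}, forall x, p.[x] = rodrigues n x.
Proof.
suff [p Hp] : exists p : {poly R}, forall x,
    derive1n n (fun t : R => expR (- t ^+ 2)) x = p.[x] * expR (- x ^+ 2).
  exists ((-1) ^+ n *: p) => x.
  rewrite /rodrigues Hp hornerZ expRN.
  have : expR (x ^+ 2) != 0 by rewrite gt_eqF ?expR_gt0.
  by move: (expR _) => e e0; field.
elim: n => [|n [p Hp]]; first by exists 1 => x; rewrite hornerC mul1r.
exists (deriv p - (2%:R *: 'X) * p) => x.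
rewrite derive1nS (_ : derive1n n _ = fun x => p.[x] * expR (- x ^+ 2));
  last exact/funext.
have Hs : is_derive x (1 : R) (fun t : R => - t ^+ 2) (- (2%:R * x)).
  apply: is_deriveN; apply: is_derive_eq.
  by rewrite /GRing.scale/= mulr1 mulr_natl.
have He : is_derive x (1 : R) (fun t : R => expR (- t ^+ 2))
    (expR (- x ^+ 2) * - (2%:R * x)).
  exact: (is_derive1_comp (is_derive_expR _) Hs).
have Hm := is_deriveM (is_derive_poly p x) He.
rewrite derive1E (@derive_val _ _ _ _ _ _ _ Hm) !hornerE /GRing.scale/=.
by ring.
Qed.

Lemma hermiteE (R : realType) (n : nat) (x : R) :
  (hermite R n).[x] = rodrigues n x.
Proof.
have [p Hp] := rodrigues_poly R n.
exact: (@xgetPex _ 0 [set q : {poly R} | forall x, q.[x] = rodrigues n x]%classic (ex_intro _ p Hp) x).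
Qed.

Definition wronskian (K : comNzRingType) (f : seq {poly K}) : {poly K} :=
  \det (\matrix_(i < size f, j < size f) derivn i f`_j).

Definition exc_hermite (R : realType) (k : seq nat) (n : nat) : {poly R} :=
  wronskian (rcons [seq hermite R j | j <- k] (hermite R n)).

Definition cpoly (R : realType) (p : {poly R}) : {poly R[i]} :=
  map_poly (real_complex R) p.

(* Type ascription under which the topology that the library puts on every
   [numFieldType] is found on [R[i]]. *)
Definition cseq (R : realType) (u : nat -> R[i]) : nat -> (R[i] : numFieldType) :=
  u.

Definition csummable (R : realType) (u : nat -> R[i]) : Prop :=
  cvgn (series (cseq u)).

Definition csum (R : realType) (u : nat -> R[i]) : R[i] :=
  limn (series (cseq u)).

Definition mehler_term (R : realType) (z x y : R[i]) (n : nat) : R[i] :=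
  z ^+ n * ((cpoly (hermite R n)).[x] * (cpoly (hermite R n)).[y])
    / ((2 ^ n * n`!)%N%:R).

Definition mehler (R : realType) (z x y : R[i]) : R[i] :=
  csum (mehler_term z x y).

(* The indices in [k], where the denominator vanishes, are left out of the
   series by giving them the term 0. *)
Definition exc_mehler_term (R : realType) (k : seq nat) (z x y : R[i])
    (n : nat) : R[i] :=
  if n \in k then 0 else
  z ^+ n * ((cpoly (exc_hermite R k n)).[x] * (cpoly (exc_hermite R k n)).[y])
    / ((2 ^ (n + size k) * n`!)%N%:R * \prod_(j <- k) (n%:R - j%:R)).

Definition exc_mehler (R : realType) (k : seq nat) (z x y : R[i]) : R[i] :=
  csum (exc_mehler_term k z x y).

(* Main.v *)
Require Import Defs.
From HB Require Import structures.
From mathcomp Require Import all_boot all_order all_algebra.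
From mathcomp Require Import complex.
From mathcomp Require Import all_classical all_reals all_analysis.
From mathcomp Require Import ring lra.

(** Put D = z d/dz and s = 1 - z^2, and regard the Mehler series E as a power
    series in z whose coefficients e_n = H_n(x) H_n(y) / (2^n n!) are
    polynomials in x and y.  The relations H_n' = 2n H_(n-1) and
    H_(n+1) = 2x H_n - H_n' give, coefficient by coefficient,
      s d_x E = (2yz - 2xz^2) E,   s d_y E = (2xz - 2yz^2) E,   s^2 D E = g E,
    where g is a polynomial with g(1) = -2 (x - y)^2 and g(-1) = -2 (x + y)^2.
    Call F a rational multiple of E of degree at most d when s^N F = P E for
    some N and some polynomial P of degree at most d + 2N in z: then F / E has
    poles at most at z = 1 and z = -1, and grows at most like z^d at
    infinity.  Sums, products by polynomials in x and y, and both partial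
    derivatives preserve the bound d ([rat_mult_derivation]).

    One index.  If u_(k,n)(x) stands for e^(x^2) times the integral over
    [x, oo) of e^(-t^2) H_k(t) H_n(t), then Wr[H_k, H_n] = 2 (n - k) u_(k,n), so
    dividing by n - k costs nothing, and E_k is the Wronskian in y of
    H_k(y) with U_k = sum_n z^n u_(k,n)(x) H_n(y) / (2^n n!).  Integration by
    parts gives U_k = z^k H_k(y) U_0 + T_k with T_k a rational multiple of E of
    degree k + 1.  Only U_0, an error function, is not one; but
    d_y U_0 = z E, and Wr_y[H_k, H_k U_0] = H_k(y)^2 d_y U_0, so it disappears
    ([rat_mehler_one_index]).

    Several indices.  The operator A f = Wr[H_(k_1), ..., H_(k_l), f] kills each
    h = H_(k_j), hence h^l A f = B (Wr[h, f]) for a differential operator B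
    ([diffop_factor]).  Splitting 1 / prod_j (n - k_j) into partial fractions
    reduces E_k to one-index series to which such operators B are applied in x
    and in y.  So, for some nonzero polynomial H in x and y, the series H E_k is
    a rational multiple of E of degree at most k_l + 1
    ([quasi_rat_exc_ps]).

    No poles.  Let A_x and A_y be the operator A acting in x and in y.  Then
    prod_j (D - k_j) E_k = 2^(-l) A_x A_y E has at 1 and -1 poles of order at
    most 2l relative to E, one for each derivative.  But D - k_j
    raises the order of a pole by exactly two, because g does not vanish at 1
    and -1.  So H E_k = P E with P a polynomial of degree at most k_l + 1
    in z ([rat_mult_no_pole]).  Since e_0 = 1, the coefficients of E_k / E are
    polynomials in x and y, so H divides P ([quotient_poly]), and
    E_k = E Q as formal series.

    Convergence.  The three-term recurrence gives
    |H_n(x)|^2 = O(q^n 2^n n!) for every q > 1, so the Mehler series converges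
    absolutely for |z| < 1; the series of E_k is a finite combination of its
    shifts, and the formal identity becomes an identity of sums
    ([series_act]). *)

Set Implicit Arguments.
Unset Strict Implicit.
Unset Printing Implicit Defensive.

Import Order.TTheory GRing.Theory Num.Theory.
Import numFieldNormedType.Exports.

Local Open Scope ring_scope.
Local Open Scope complex_scope.

(** * Power series acted on by polynomials *)
Section Series.
Variable A : comNzRingType.
Implicit Types (P Q : {poly A}) (f g : nat -> A).

(** A power series in z is given by its coefficients [f], and [act P f] is its
    product with the polynomial [P] in z. *)
Definition act P f : nat -> A := fun n => \sum_(i < n.+1) P`_i * f (n - i)%N.

Lemma act_trunc P f m n : (n < m)%N ->
  act P f n = (P * \poly_(i < m) f i)`_n.
Proof.
move=> nm; rewrite coefM; apply: eq_bigr => i _.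
by rewrite coef_poly (leq_ltn_trans (leq_subr _ _) nm).
Qed.

Lemma act_mul P Q f : act (P * Q) f = act P (act Q f).
Proof.
apply/funext => n; rewrite (act_trunc _ _ (ltnSn n)) -mulrA coefM.
apply: eq_bigr => i _; congr (_ * _).
by rewrite (@act_trunc _ _ n.+1) // ltnS leq_subr.
Qed.

Lemma act_addl P Q f : act (P + Q) f = fun n => act P f n + act Q f n.
Proof.
apply/funext => n; rewrite -big_split; apply: eq_bigr => i _.
by rewrite coefD mulrDl.
Qed.

Lemma act_addr P f g : act P (fun n => f n + g n) = fun n => act P f n + act P g n.
Proof.
apply/funext => n; rewrite -big_split; apply: eq_bigr => i _.
by rewrite mulrDr.
Qed.

Lemma act_scalel c P f : act (c *: P) f = fun n => c * act P f n.
Proof.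
apply/funext => n; rewrite mulr_sumr; apply: eq_bigr => i _.
by rewrite coefZ mulrA.
Qed.

Lemma act_scaler c P f : act P (fun n => c * f n) = fun n => c * act P f n.
Proof.
apply/funext => n; rewrite mulr_sumr; apply: eq_bigr => i _.
by rewrite mulrCA.
Qed.

Lemma actC c f : act c%:P f = fun n => c * f n.
Proof.
apply/funext => n; rewrite /act big_ord_recl coefC eqxx subn0.
by rewrite big1 ?addr0 // => i _; rewrite coefC /= mul0r.
Qed.

Lemma act0 f n : act 0 f n = 0.
Proof. by rewrite /act big1 // => i _; rewrite coef0 mul0r. Qed.

Lemma act1 f : act 1 f = f.
Proof. by rewrite -polyC1 actC; apply/funext => n; rewrite mul1r. Qed.

Lemma actX f n : act 'X f n = if n is m.+1 then f m else 0.
Proof.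
rewrite /act; case: n => [|n]; first by rewrite big_ord1 coefX mul0r.
rewrite big_ord_recl coefX mul0r add0r big_ord_recl coefX /= mul1r subSS subn0.
by rewrite big1 ?addr0 // => i _; rewrite coefX mul0r.
Qed.

Lemma act_subl P Q f : act (P - Q) f = fun n => act P f n - act Q f n.
Proof.
by rewrite -scaleN1r act_addl act_scalel; apply/funext => n; rewrite mulN1r.
Qed.

(** Coefficients of [P] can be read off from low to high, because [f] starts
    with 1. *)
Lemma act_coef_inj f m P Q : f 0%N = 1 ->
  (forall i, (i < m)%N -> act P f i = act Q f i) ->
  forall i, (i < m)%N -> P`_i = Q`_i.
Proof.
move=> f0 eqPQ; elim/ltn_ind => n IH nm.
have := eqPQ n nm.
rewrite /act !big_ord_recr /= subnn f0 !mulr1 => /eqP.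
rewrite (eq_bigr (fun i : 'I_n => Q`_i * f (n - i)%N)) => [|i _].
  by rewrite (inj_eq (addrI _)) => /eqP.
by rewrite IH // (ltn_trans _ nm).
Qed.

Lemma act_inj f P Q : f 0%N = 1 -> act P f = act Q f -> P = Q.
Proof.
move=> f0 eqPQ; apply/polyP => n.
by apply: (act_coef_inj f0 _ (ltnSn n)) => i _; rewrite eqPQ.
Qed.

Lemma act_cancel P f g : P`_0 = 1 -> act P f = act P g -> f = g.
Proof.
move=> P0 eqfg; apply/funext => n; elim/ltn_ind: n => n IH.
have := congr1 (fun h => h n) eqfg.
rewrite /act !big_ord_recl P0 !mul1r subn0 => /eqP.
rewrite (eq_bigr (fun i : 'I_n => P`_(lift ord0 i) * g (n - lift ord0 i)%N)); last first.
  by move=> i _; rewrite IH // ltn_subrL /= (leq_ltn_trans _ (ltn_ord i)).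
by rewrite (inj_eq (addIr _)) => /eqP.
Qed.

(** The operator z d/dz. *)
Definition euler f : nat -> A := fun n => n%:R * f n.

Lemma euler_act P f :
  euler (act P f) = fun n => act ('X * P^`()) f n + act P (euler f) n.
Proof.
apply/funext => n; rewrite /euler /act mulr_sumr -big_split /=.
apply: eq_bigr => i _.
have -> : ('X * P^`())`_i = i%:R * P`_i.
  rewrite mulrC coefMX; case: (nat_of_ord i) => [|j] /=; first by rewrite mul0r.
  by rewrite coef_deriv mulr_natl.
rewrite -{1}(subnKC (ltn_ord i : (i <= n)%N)) natrD; ring.
Qed.

Definition derivation (d : A -> A) :=
  (forall a b, d (a + b) = d a + d b) /\ (forall a b, d (a * b) = d a * b + a * d b).

Lemma derivation0 d : derivation d -> d 0 = 0.
Proof. by case=> dD _; apply: (addrI (d 0)); rewrite -dD !addr0. Qed.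

Lemma derivation_sum d I (r : seq I) (G : I -> A) : derivation d ->
  d (\sum_(i <- r) G i) = \sum_(i <- r) d (G i).
Proof. by move=> dd; apply: (big_morph d (dd.1) (derivation0 dd)). Qed.

Lemma derivationN d a : derivation d -> d (- a) = - d a.
Proof.
by move=> dd; apply: (addrI (d a)); rewrite -dd.1 !subrr derivation0.
Qed.

Lemma derivation_natr d n : derivation d -> d n%:R = 0.
Proof.
move=> dd; have d1 : d 1 = 0.
  by apply: (addrI (d 1)); rewrite addr0 -[in RHS](mul1r 1) dd.2 mulr1 mul1r.
by elim: n => [|n IH]; rewrite ?derivation0 // -natr1 dd.1 IH d1 addr0.
Qed.

Lemma derivation_act d P f : derivation d ->
  (fun n => d (act P f n)) =
  fun n => act (map_poly d P) f n + act P (fun m => d (f m)) n.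
Proof.
move=> dd; apply/funext => n; rewrite derivation_sum // -big_split.
apply: eq_bigr => i _; rewrite dd.2; congr (_ * _ + _).
by rewrite coef_map_id0 ?derivation0.
Qed.

Lemma derivation_actXn d k f : derivation d ->
  (fun n => d (act 'X^k f n)) = act 'X^k (fun m => d (f m)).
Proof.
move=> dd; rewrite derivation_act //; apply/funext => n.
have -> : map_poly d 'X^k = 0.
  apply/polyP => i; rewrite coef_map_id0 ?derivation0 // coefXn coef0.
  exact: derivation_natr.
by rewrite act0 add0r.
Qed.

End Series.

(** * Rational multiples of a power series *)

(** Locked, so that lemmas about sums of polynomials do not match it. *)
Definition one_sub_sqX (A : comNzRingType) : {poly A} := locked (1 - 'X^2).

Section Rational.
Variables (A : idomainType) (E : nat -> A).
Hypothesis E0 : E 0%N = 1.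
Local Notation s := (one_sub_sqX A).

(** The quotient of [f] by [E] is a rational function of z whose denominator is
    [s ^+ N] and whose degree, numerator minus denominator, is at most [d]. *)
Definition rat_mult (N d : nat) (f : nat -> A) : Prop :=
  exists2 P : {poly A}, (size P <= (d + N.*2).+1)%N & act (s ^+ N) f = act P E.

Lemma one_sub_sqXE : s = 1 - 'X^2.
Proof. by rewrite /one_sub_sqX -lock. Qed.

Lemma coef0_one_sub_sqX N : (s ^+ N)`_0 = 1.
Proof.
elim: N => [|N IH]; first by rewrite expr0 coefC.
by rewrite exprS coef0M IH one_sub_sqXE coefB coefC coefXn subr0 mulr1.
Qed.

Lemma size_one_sub_sqX : (size s <= 3)%N.
Proof.
by rewrite one_sub_sqXE (leq_trans (size_polyD _ _)) // size_polyN size_polyXn size_poly1.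
Qed.

Lemma size_mulle (P Q : {poly A}) a b :
  (size P <= a.+1)%N -> (size Q <= b.+1)%N -> (size (P * Q)%R <= (a + b).+1)%N.
Proof.
move=> Pa Qb; apply: leq_trans (size_polyMleq _ _) _.
by rewrite -subn1 leq_subLR add1n -addSn -addnS leq_add.
Qed.

Lemma size_addle (P Q : {poly A}) a :
  (size P <= a)%N -> (size Q <= a)%N -> (size (P + Q)%R <= a)%N.
Proof. by move=> Pa Qa; rewrite (leq_trans (size_polyD _ _)) // geq_max Pa. Qed.

Lemma addn_doubleS d N : (d + N.+1.*2 = 2 + (d + N.*2))%N.
Proof. by rewrite doubleS !addnS. Qed.

Lemma rat_mult_self : rat_mult 0 0 E.
Proof. by exists 1; rewrite ?size_poly1 // expr0. Qed.

Lemma rat_mult_raise N d f : rat_mult N d f -> rat_mult N.+1 d f.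
Proof.
case=> P sP e; exists (s * P); last by rewrite exprS !act_mul e.
by rewrite addn_doubleS; apply: size_mulle; first exact: size_one_sub_sqX.
Qed.

Lemma rat_mult_le N d N' d' f : (N <= N')%N -> (d <= d')%N ->
  rat_mult N d f -> rat_mult N' d' f.
Proof.
move=> NN' dd' fN; have {fN} : rat_mult N d' f.
  case: fN => P sP e; exists P => //; apply: leq_trans sP _.
  by rewrite ltnS leq_add2r.
rewrite -(subnK NN'); elim: (N' - N)%N => // m IH fN.
by rewrite addSn; apply/rat_mult_raise/IH.
Qed.

Lemma rat_mult_add N d f g : rat_mult N d f -> rat_mult N d g ->
  rat_mult N d (fun n => f n + g n).
Proof.
move=> [P sP eP] [Q sQ eQ]; exists (P + Q); first exact: size_addle.
by rewrite act_addr act_addl eP eQ.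
Qed.

Lemma rat_mult_scale N d c f : rat_mult N d f -> rat_mult N d (fun n => c * f n).
Proof.
move=> [P sP eP]; exists (c *: P); first exact: leq_trans (size_scale_leq _ _) _.
by rewrite act_scaler act_scalel eP.
Qed.

Lemma rat_mult_sum N d I (r : seq I) (c : I -> nat -> A) :
  (forall i, rat_mult N d (c i)) -> rat_mult N d (fun n => \sum_(i <- r) c i n).
Proof.
move=> H; elim: r => [|i r IH].
  exists 0; rewrite ?size_poly0 //; apply/funext => n.
  rewrite /act !big1 // => i _; rewrite ?big_nil ?mulr0 //.
  by rewrite coef0 mul0r.
rewrite (_ : (fun n => _) = fun n => c i n + \sum_(i <- r) c i n).
  exact: rat_mult_add.
by apply/funext => n; rewrite big_cons.
Qed.

Lemma rat_mult_mulX N d f : rat_mult N d f -> rat_mult N d.+1 (act 'X f).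
Proof.
move=> [P sP e]; exists ('X * P); last by rewrite -act_mul mulrC !act_mul e.
by rewrite addSn -(add1n (_ + _)); apply: size_mulle; rewrite ?size_polyX.
Qed.

Lemma derivation_one_sub_sqX d N : derivation d -> map_poly d (s ^+ N) = 0.
Proof.
move=> dd; apply/polyP => i; rewrite coef_map_id0 ?derivation0 // coef0.
elim: N i => [|N IH] i; first by rewrite expr0 coef1 derivation_natr.
rewrite exprS coefM derivation_sum // big1 // => j _; rewrite dd.2 IH mulr0 addr0.
rewrite one_sub_sqXE coefB coef1 coefXn dd.1 derivationN // !derivation_natr //.
by rewrite subrr mul0r.
Qed.

(** If the logarithmic derivative of [E] is [u / s] with [u] of degree at most 2,
    it stays bounded as z grows: differentiating adds a pole and leaves the
    degree alone. *)
Lemma rat_mult_derivation (d : A -> A) (u : {poly A}) N b f :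
  derivation d -> (size u <= 3)%N ->
  act s (fun n => d (E n)) = act u E ->
  rat_mult N b f -> rat_mult N.+1 b (fun n => d (f n)).
Proof.
move=> dd su eu [P sP e].
have ds0 := derivation_one_sub_sqX N dd.
exists (s * map_poly d P + P * u).
  apply: size_addle.
    rewrite addn_doubleS; apply: size_mulle.
      exact: size_one_sub_sqX.
    exact: leq_trans (size_poly _ _) sP.
  by rewrite addn_doubleS (addnC 2); apply: size_mulle.
have := congr1 (fun h n => d (h n)) e.
rewrite /= !derivation_act // ds0 => e2.
rewrite exprS act_mul.
have -> : act (s ^+ N) (fun n => d (f n)) =
   fun n => act (map_poly d P) E n + act P (fun m => d (E m)) n.
  rewrite -e2; apply/funext => n.
  by rewrite act0 add0r.
by rewrite act_addr [in RHS]act_addl; apply/funext => n; rewrite !act_mul -eu -!act_mul (mulrC P).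
Qed.

Section Poles.
Variable g : {poly A}.
Hypothesis gE : act (s ^+ 2) (euler E) = act g E.

(** With [E] as unit, z d/dz acts on the numerator [P] over [s ^+ N] as
    multiplication by [g] up to multiples of [s], at the price of the denominator
    [s ^+ N.+2]; the conclusion records the new numerator at the two roots of [s].
    The constant [c] only contributes a multiple of [s]. *)
Lemma euler_act_eq N P f c : act (s ^+ N) f = act P E ->
  exists2 P1 : {poly A}, P1.[1] = g.[1] * P.[1] /\ P1.[-1] = g.[-1] * P.[-1] &
  act (s ^+ N.+2) (fun n => (n%:R - c) * f n) = act P1 E.
Proof.
move=> e.
exists (s ^+ 2 * ('X * P^`()) + P * g - 'X * (s * s^`() * P *+ N) - c *: (s ^+ 2 * P)).
  have s1 : s.[1] = 0 by rewrite one_sub_sqXE !hornerE expr1n subrr.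
  have sN1 : s.[-1] = 0 by rewrite one_sub_sqXE !hornerE sqrrN expr1n subrr.
  by split; rewrite !(hornerD, hornerN, hornerM, horner_exp, hornerZ, hornerMn)
    ?s1 ?sN1 ?expr0n /= !(mul0r, mul0rn, mulr0, add0r, subr0) mulrC.
have eD : (fun n => (n%:R - c) * f n) = fun n => euler f n + (- c) * f n.
  by apply/funext => n; rewrite /euler mulrBl mulNr.
have := congr1 (@euler A) e; rewrite !euler_act => eE.
rewrite eD act_addr act_scaler -addn2 exprD.
have -> : act (s ^+ N * s ^+ 2) (euler f) = fun n =>
   act (s^+2 * ('X * P^`()) + P * g) E n - act ('X * (s * s^`() * P *+ N)) E n.
  rewrite (mulrC (s ^+ N)) [LHS]act_mul.
  have -> : act (s ^+ N) (euler f) = fun n =>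
    (act ('X * P^`()) E n + act P (euler E) n) - act ('X * (s ^+ N)^`()) f n.
    apply/funext => n; have /(congr1 (fun h => h n)) /= <- := eE.
    by rewrite addrC addKr.
  have negE (h : nat -> A) : (fun n => - h n) = (fun n => (-1) * h n).
    by apply/funext => n; rewrite mulN1r.
  rewrite act_addr (negE (act _ f)) act_scaler act_addr act_addl -!act_mul.
  apply/funext => n; rewrite mulN1r; congr (_ + _ - _).
    by rewrite (mulrC (s ^+ 2)) !(act_mul P) gE.
  case: N e {eE eD} => [|N] e.
    by rewrite expr0 derivC ?mulr0n !mulr0 !act0.
  rewrite deriv_exp -[N.+1.-1]/N.
  rewrite (_ : s ^+ 2 * _ = ('X * (s * s^`() *+ N.+1)) * s ^+ N.+1); last first.
    rewrite !(mulrnAr, mulrnAl); congr (_ *+ _); rewrite (exprS s N); ring.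
  by rewrite act_mul e -act_mul; congr (act _ E n); rewrite !(mulrnAr, mulrnAl) !mulrA.
have -> : act (s ^+ N * s ^+ 2) f = act (s ^+ 2 * P) E.
  by rewrite (mulrC (s ^+ N)) !(act_mul (s ^+ 2)) e.
by apply/funext => n; rewrite !act_subl act_scalel mulNr.
Qed.

Lemma eulers_act_eq (ks : seq A) N P f : act (s ^+ N) f = act P E ->
  exists2 P1 : {poly A},
   P1.[1] = g.[1] ^+ size ks * P.[1] /\ P1.[-1] = g.[-1] ^+ size ks * P.[-1] &
   act (s ^+ (N + (size ks).*2)) (fun n => \prod_(c <- ks) (n%:R - c) * f n)
     = act P1 E.
Proof.
move=> e; elim: ks => [|c ks [P1 [v1 v2] e1]].
  exists P; first by rewrite !mul1r.
  rewrite addn0 -e; congr act; apply/funext => n; by rewrite big_nil mul1r.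
have [P2 [w1 w2] e2] := euler_act_eq c e1.
exists P2; first by rewrite w1 w2 v1 v2 !mulrA -!exprS.
rewrite doubleS !addnS -e2; congr act; apply/funext => n.
by rewrite big_cons mulrA.
Qed.

Hypotheses (g1 : g.[1] != 0) (gN1 : g.[-1] != 0) (two0 : (2%:R : A) != 0).

(** Each factor z d/dz - c raises the order of a pole at 1 or -1 by exactly two.
    If the product over [ks] leaves a pole of order at most twice [size ks], there
    was none to start with. *)
Lemma rat_mult_no_pole (ks : seq A) N d d' f : rat_mult N d f ->
  rat_mult (size ks).*2 d' (fun n => \prod_(c <- ks) (n%:R - c) * f n) ->
  rat_mult 0 d f.
Proof.
move=> fN [R _ eR]; elim: N fN => // N IH [P sP e].
have [P1 [v1 v2] e1] := eulers_act_eq ks e.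
(* The denominator [s ^+ N.+1] is superfluous in the image, so the numerator
   [P1] vanishes at 1 and -1, and so does [P]. *)
have P1E : P1 = s ^+ N.+1 * R.
  by apply: (act_inj E0); rewrite -e1 exprD !act_mul eR.
have s1 : s.[1] = 0 by rewrite one_sub_sqXE !hornerE expr1n subrr.
have sN1 : s.[-1] = 0 by rewrite one_sub_sqXE !hornerE sqrrN expr1n subrr.
have P_1 : P.[1] = 0.
  apply/eqP; move/eqP: v1; rewrite P1E hornerM exprS hornerM s1 !mul0r eq_sym.
  by rewrite mulf_eq0 expf_eq0 (negPf g1) andbF.
have P_N1 : P.[-1] = 0.
  apply/eqP; move/eqP: v2; rewrite P1E hornerM exprS hornerM sN1 !mul0r eq_sym.
  by rewrite mulf_eq0 expf_eq0 (negPf gN1) andbF.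
have [q Pq] : exists q, P = q * ('X - 1%:P) by apply/factor_theorem/eqP.
have [r qr] : exists r, q = r * ('X - (-1)%:P).
  apply/factor_theorem/eqP; apply/eqP; move/eqP: P_N1.
  rewrite Pq !hornerE mulf_eq0 orbC -opprD oppr_eq0 -[1 + 1]/(2%:R) (negPf two0) /=.
  by [].
have Pr : P = s * (- r) by rewrite Pq qr one_sub_sqXE; ring.
apply: IH; exists (- r); last first.
  apply: (act_cancel (coef0_one_sub_sqX 1)).
  by rewrite expr1 -!act_mul -exprS -Pr e.
rewrite size_polyN; have [->|r0] := eqVneq r 0; first by rewrite size_poly0.
move: sP; rewrite Pq qr size_Mmonic ?monicXsubC ?mulf_neq0 ?polyXsubC_eq0 //.
rewrite size_Mmonic ?monicXsubC //.
by rewrite !size_XsubC doubleS !addnS /= ?addn0 ?addn1 !ltnS.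
Qed.

End Poles.
End Rational.

(** * Hermite polynomials and the Mehler series *)
Section MehlerSeries.
Variable F : numFieldType.
Local Notation A := {poly {poly F}}.
Implicit Types (p q : {poly F}) (a b : nat -> {poly F}) (c : nat -> F).

Fixpoint herm (n : nat) : {poly F} :=
  if n is m.+1 then 2 * 'X * herm m - (herm m)^`() else 1.

Arguments herm : simpl never.

Lemma hermS n : herm n.+1 = 2 * 'X * herm n - (herm n)^`().
Proof. by []. Qed.

Lemma deriv2X p : (2 * 'X * p)^`() = 2 * p + 2 * 'X * p^`().
Proof. by rewrite -mulrA !mulr_natl derivMn derivM derivX mul1r mulrnDl mulrnAl. Qed.

Lemma deriv_natM n p : (n%:R * p)^`() = n%:R * p^`().
Proof. by rewrite !mulr_natl derivMn. Qed.

Lemma deriv_herm n : (herm n)^`() = (2 * n)%:R * herm n.-1.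
Proof.
elim: n => [|n IH]; first by rewrite derivC mul0r.
rewrite hermS derivB deriv2X IH deriv_natM /=.
case: n IH => [|n] IH; first by rewrite /= derivC; ring.
by rewrite hermS /=; ring.
Qed.

Lemma herm_ode n : (2 * n)%:R * herm n = 2 * 'X * (herm n)^`() - (herm n)^`()^`().
Proof.
case: n => [|n]; first by rewrite /= derivC deriv0; ring.
by rewrite [in RHS]deriv_herm deriv_natM hermS /=; ring.
Qed.

Lemma herm_neq0 n : herm n != 0.
Proof.
elim: n => [|n IH]; first exact: oner_neq0.
apply/eqP => h0; have := deriv_herm n.+1.
rewrite h0 deriv0 => /esym/eqP; rewrite mulf_eq0 (negPf IH) orbF.
by rewrite -polyC_natr polyC_eq0 pnatr_eq0.
Qed.

(** Polynomials in x and y are polynomials in x over the ring of polynomials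
    in y. *)
Definition inx p : A := p^:P.
Definition iny p : A := p%:P.
Definition scal (x : F) : A := x%:P%:P.
Definition dx (P : A) : A := P^`().
Definition dy (P : A) : A := map_poly deriv P.

Lemma inxM p q : inx (p * q) = inx p * inx q. Proof. exact: rmorphM. Qed.
Lemma inxD p q : inx (p + q) = inx p + inx q. Proof. exact: rmorphD. Qed.
Lemma inxB p q : inx (p - q) = inx p - inx q. Proof. exact: rmorphB. Qed.
Lemma inxn n : inx n%:R = n%:R. Proof. exact: rmorph_nat. Qed.
Lemma inyM p q : iny (p * q) = iny p * iny q. Proof. exact: rmorphM. Qed.
Lemma inyB p q : iny (p - q) = iny p - iny q. Proof. exact: rmorphB. Qed.
Lemma inyn n : iny n%:R = n%:R. Proof. exact: rmorph_nat. Qed.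
Lemma inx0 : inx 0 = 0. Proof. exact: rmorph0. Qed.
Lemma iny0 : iny 0 = 0. Proof. exact: rmorph0. Qed.
Lemma scalM x y : scal (x * y) = scal x * scal y.
Proof. by rewrite /scal !rmorphM. Qed.
Lemma scalB x y : scal (x - y) = scal x - scal y.
Proof. by rewrite /scal !rmorphB. Qed.
Lemma scaln n : scal n%:R = n%:R.
Proof. by rewrite /scal !rmorph_nat. Qed.

Lemma derivation_dx : derivation dx.
Proof. by split=> P Q; rewrite /dx ?derivD ?derivM. Qed.

Lemma derivation_dy : derivation dy.
Proof.
split=> P Q; first by rewrite /dy raddfD.
apply/polyP => i; rewrite coefD coef_map /= !coefM raddf_sum -big_split /=.
by apply: eq_bigr => j _; rewrite derivM !coef_map.
Qed.

Lemma dx_inx p : dx (inx p) = inx p^`().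
Proof. exact: deriv_map. Qed.
Lemma dx_iny p : dx (iny p) = 0.
Proof. exact: derivC. Qed.
Lemma dx_scal x : dx (scal x) = 0.
Proof. exact: derivC. Qed.
Lemma dy_inx p : dy (inx p) = 0.
Proof. by apply/polyP => i; rewrite !coef_map /= derivC coef0. Qed.
Lemma dy_iny p : dy (iny p) = iny p^`().
Proof. by rewrite /dy /iny map_polyC. Qed.
Lemma dy_scal x : dy (scal x) = 0.
Proof. by rewrite dy_iny derivC /iny. Qed.

Definition biseries c a b : nat -> A := fun n => inx (a n) * iny (b n) * scal (c n).

Lemma dx_biseries c a b :
  (fun n => dx (biseries c a b n)) = biseries c (fun n => (a n)^`()) b.
Proof.
apply/funext => n; rewrite /biseries !derivation_dx.2 dx_inx dx_iny dx_scal.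
by rewrite !mulr0 !addr0.
Qed.

Lemma dy_biseries c a b :
  (fun n => dy (biseries c a b n)) = biseries c a (fun n => (b n)^`()).
Proof.
apply/funext => n; rewrite /biseries !derivation_dy.2 dy_inx dy_iny dy_scal.
by rewrite mulr0 addr0 mul0r add0r.
Qed.

Definition mehler_wt (n : nat) : F := ((2 ^ n * n`!)%N%:R)^-1.

Lemma mehler_wtS n : (2 * n.+1)%:R * scal (mehler_wt n.+1) = scal (mehler_wt n).
Proof.
rewrite -scaln -scalM; congr scal; rewrite /mehler_wt expnS factS.
rewrite (_ : (2 * 2 ^ n * (n.+1 * n`!) = 2 * n.+1 * (2 ^ n * n`!))%N); last by ring.
by rewrite [in X in _ * X]natrM invfM mulrA divff ?mul1r // pnatr_eq0.
Qed.

(** The factor 2n turns the weight 1 / (2^n n!) into that of n - 1, so lowering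
    the index in x amounts to raising it in y and multiplying by z. *)
Lemma biseries_shiftx a b :
  biseries mehler_wt (fun n => (2 * n)%:R * a n.-1) b =
    act 'X (biseries mehler_wt a (fun n => b n.+1)).
Proof.
apply/funext => -[|n]; rewrite actX /biseries; first by rewrite muln0 mul0r inx0 !mul0r.
by rewrite inxM inxn -(mehler_wtS n) /=; ring.
Qed.

Lemma biseries_shifty a b :
  biseries mehler_wt a (fun n => (2 * n)%:R * b n.-1) =
    act 'X (biseries mehler_wt (fun n => a n.+1) b).
Proof.
apply/funext => -[|n]; rewrite actX /biseries.
  by rewrite muln0 mul0r iny0 mulr0 mul0r.
by rewrite inyM inyn -(mehler_wtS n) /=; ring.
Qed.

Local Notation X := (inx 'X).
Local Notation Y := (iny 'X).
Local Notation s := (one_sub_sqX A).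

Definition mehler_ps : nat -> A := biseries mehler_wt herm herm.

Local Notation E := mehler_ps.

Lemma mehler_ps0 : E 0%N = 1.
Proof. by rewrite /mehler_ps /biseries /mehler_wt /inx /iny /scal !rmorph1 invr1 !mulr1. Qed.

Lemma biseries_hermSx c b :
  biseries c (fun n => herm n.+1) b =
    fun n => 2 * X * biseries c herm b n + (-1) * dx (biseries c herm b n).
Proof.
apply/funext => n; have /(congr1 (fun h => h n)) /= -> := dx_biseries c herm b.
by rewrite /biseries /= hermS inxB !inxM inxn; ring.
Qed.

Lemma biseries_hermSy c a :
  biseries c a (fun n => herm n.+1) =
    fun n => 2 * Y * biseries c a herm n + (-1) * dy (biseries c a herm n).
Proof.
apply/funext => n; have /(congr1 (fun h => h n)) /= -> := dy_biseries c a herm.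
by rewrite /biseries /= hermS inyB !inyM inyn; ring.
Qed.

Lemma dx_mehler_ps : (fun n => dx (E n)) = act 'X (fun n => 2 * Y * E n + (-1) * dy (E n)).
Proof.
rewrite dx_biseries -biseries_hermSy -biseries_shiftx.
by congr (biseries _ _ _); apply/funext => n; rewrite deriv_herm.
Qed.

Lemma dy_mehler_ps : (fun n => dy (E n)) = act 'X (fun n => 2 * X * E n + (-1) * dx (E n)).
Proof.
rewrite dy_biseries -biseries_hermSx -biseries_shifty.
by congr (biseries _ _ _); apply/funext => n; rewrite deriv_herm.
Qed.

(** Over the denominator [s], the logarithmic derivative of the Mehler series
    with respect to [u]. *)
Definition log_deriv (u v : A) : {poly A} := (2 * v) *: 'X - (2 * u) *: 'X^2.

(** Obtained by eliminating d_y E between d_x E = z (2y - d_y) E and its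
    mirror image. *)
Lemma dx_mehler_ps_rat : act s (fun n => dx (E n)) = act (log_deriv X Y) E.
Proof.
apply/funext => n; rewrite one_sub_sqXE act_subl act1.
have /(congr1 (fun h => h n)) /= -> := dx_mehler_ps.
rewrite act_addr !act_scaler dy_mehler_ps expr2 act_mul.
rewrite !act_addr !act_scaler /log_deriv act_subl !act_scalel expr2 act_mul.
ring.
Qed.

Lemma dy_mehler_ps_rat : act s (fun n => dy (E n)) = act (log_deriv Y X) E.
Proof.
apply/funext => n; rewrite one_sub_sqXE act_subl act1.
have /(congr1 (fun h => h n)) /= -> := dy_mehler_ps.
rewrite act_addr !act_scaler dx_mehler_ps expr2 act_mul.
rewrite !act_addr !act_scaler /log_deriv act_subl !act_scalel expr2 act_mul.
ring.
Qed.

Lemma size_log_deriv u v : (size (log_deriv u v) <= 3)%N.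
Proof.
rewrite /log_deriv (leq_trans (size_polyD _ _)) // size_polyN geq_max.
by rewrite !(leq_trans (size_scale_leq _ _)) ?size_polyX ?size_polyXn.
Qed.

Definition rat_mehler := rat_mult E.

Lemma rat_mehler_dx N d f : rat_mehler N d f -> rat_mehler N.+1 d (fun n => dx (f n)).
Proof. exact: (rat_mult_derivation derivation_dx (size_log_deriv X Y) dx_mehler_ps_rat). Qed.

Lemma rat_mehler_dy N d f : rat_mehler N d f -> rat_mehler N.+1 d (fun n => dy (f n)).
Proof. exact: (rat_mult_derivation derivation_dy (size_log_deriv Y X) dy_mehler_ps_rat). Qed.

(** Over the denominator [s ^+ 2], the value on the Mehler series of the
    logarithmic derivative for z d/dz. *)
Definition euler_coef : {poly A} :=
  s * 'X^2 + (2 * X * Y) *: ('X + 'X^3) - (2 * (X ^+ 2 + Y ^+ 2)) *: 'X^2.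

Lemma two_neq0 : (2%:R : A) != 0.
Proof. by rewrite -polyC_natr polyC_eq0 -polyC_natr polyC_eq0 pnatr_eq0. Qed.

(** By the Hermite equation 2n H_n = 2x H_n' - H_n'', the operator z d/dz acts
    on the Mehler series as (2x d_x - d_x^2) / 2, and d_x is known. *)
Lemma euler_mehler_ps : act (s ^+ 2) (euler E) = act euler_coef E.
Proof.
have e1 : (fun n => 2 * euler E n) =
    fun n => 2 * X * dx (E n) + (-1) * dx (dx (E n)).
  apply/funext => n.
  have /(congr1 (fun h => h n)) /= -> := dx_biseries mehler_wt herm herm.
  have /(congr1 (fun h => h n)) /= -> := dx_biseries mehler_wt (fun n => (herm n)^`()) herm.
  have := congr1 inx (herm_ode n); rewrite /euler /mehler_ps /biseries inxB !inxM !inxn natrM => e.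
  rewrite [LHS](_ : _ = 2 * n%:R * inx (herm n) * iny (herm n) * scal (mehler_wt n)); last by ring.
  rewrite e; ring.
have e2 : act s (fun n => dx (dx (E n))) =
    fun n => act ((- 2) *: 'X^2) E n + act (log_deriv X Y) (fun n => dx (E n)) n.
  have := derivation_act s (fun n => dx (E n)) derivation_dx.
  rewrite (_ : map_poly dx s = 0); last first.
    by have := derivation_one_sub_sqX 1 derivation_dx; rewrite expr1.
  have -> : (fun n => dx (act s (fun n0 => dx (E n0)) n)) =
      fun n => dx (act (log_deriv X Y) E n) by rewrite dx_mehler_ps_rat.
  rewrite derivation_act; last exact: derivation_dx.
  have -> : map_poly dx (log_deriv X Y) = (- 2) *: 'X^2.
    apply/polyP => i; rewrite coef_map_id0 ?derivation0 //; last exact: derivation_dx.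
    have d2 (p : A) : dx (2 * p) = 2 * dx p by rewrite /dx !mulr_natl derivMn.
    rewrite /log_deriv coefB !coefZ coefX coefXn.
    case: i => [|[|[|i]]] /=; rewrite ?mulr0 ?mulr1 ?subr0 ?sub0r /dx ?derivN ?deriv0 //;
      rewrite -!/(dx _) d2.
      by rewrite dx_iny mulr0.
    by rewrite dx_inx derivX (inxn 1) mulr1.
  move=> ->; apply/funext => n.
  by rewrite act0 add0r.
apply/funext => n; apply: (mulfI two_neq0).
have <- : act (s ^+ 2) (fun n => 2 * euler E n) n = 2 * act (s ^+ 2) (euler E) n.
  by rewrite act_scaler.
rewrite e1 act_addr !act_scaler.
have -> : act (s ^+ 2) (fun n => dx (E n)) = act (s * log_deriv X Y) E.
  by rewrite expr2 !act_mul dx_mehler_ps_rat.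
have -> : act (s ^+ 2) (fun n => dx (dx (E n))) =
   act (s * ((- 2) *: 'X^2) + log_deriv X Y * log_deriv X Y) E.
  rewrite expr2 act_mul e2 act_addr [in RHS]act_addl; apply/funext => m.
  by rewrite (act_mul (log_deriv _ _)) -dx_mehler_ps_rat -!act_mul (mulrC (log_deriv _ _)).
set P := s * _ + _ * _; set Q := s * log_deriv X Y.
have -> : 2 * X * act Q E n + -1 * act P E n = act ((2 * X) *: Q - P) E n.
  by rewrite act_subl act_scalel mulN1r.
have -> : 2 * act euler_coef E n = act (2 *: euler_coef) E n by rewrite act_scalel.
congr (act _ E n); rewrite /P /Q /euler_coef /log_deriv one_sub_sqXE -!mul_polyC.
rewrite !rmorphM !rmorphD !rmorphXn /=.
move: (X%:P) (Y%:P) => x y; ring.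
Qed.

Lemma euler_coef_neq0 : euler_coef.[1] != 0 /\ euler_coef.[-1] != 0.
Proof.
have s1 : s.[1] = 0 by rewrite one_sub_sqXE !hornerE expr1n subrr.
have sN1 : s.[-1] = 0 by rewrite one_sub_sqXE !hornerE sqrrN expr1n subrr.
have XY p : X - iny p != 0 by rewrite /inx map_polyX polyXsubC_eq0.
split; rewrite /euler_coef !(hornerD, hornerN, hornerZ, hornerM, horner_exp, hornerX) ?s1 ?sN1.
  rewrite [X in X != 0](_ : _ = - (2 * (X - Y) ^+ 2)); last by ring.
  by rewrite oppr_eq0 mulf_neq0 ?two_neq0 // expf_neq0.
rewrite [X in X != 0](_ : _ = - (2 * (X - iny (- 'X)) ^+ 2)).
  by rewrite oppr_eq0 mulf_neq0 ?two_neq0 // expf_neq0.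
by rewrite /iny rmorphN; ring.
Qed.

End MehlerSeries.

Arguments herm : simpl never.

(** * The exceptional series with one index *)
Section OneIndex.
Variable F : numFieldType.
Local Notation A := {poly {poly F}}.
Local Notation Y := (iny 'X : A).
Local Notation E := (mehler_ps F).
Local Notation herm := (herm F).
Local Notation mehler_wt := (mehler_wt F).

Definition wr (p q : {poly F}) := p * q^`() - p^`() * q.

(** The polynomial u_(k,n) of [wr_cd_quot], a quotient of Christoffel-Darboux
    type.  The recurrence is integration by parts for
    e^(x^2) times the integral over [x, oo) of e^(-t^2) H_k(t) H_n(t).  The value
    at k = n, which the Wronskian does not determine, is normalised by
    u_(0,0) = 0; the integral itself is not polynomial there. *)
Fixpoint cd_quot (k : nat) (n : nat) : {poly F} :=
  if k is j.+1 then herm j * herm n + (2 * n)%:R * cd_quot j n.-1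
  else if n is m.+1 then herm m else 0.

Lemma wr_cd_quot k n : wr (herm k) (herm n) = 2 * (n%:R - k%:R) * cd_quot k n.
Proof.
rewrite /wr; elim: k n => [|k IH] n.
  by rewrite deriv_herm derivC; case: n => [|n] /=; ring.
rewrite /=; case: n => [|n].
  by rewrite (deriv_herm _ k.+1) derivC /=; ring.
rewrite /=; transitivity (2 * (n%:R - k%:R) * (herm k * herm n.+1) +
    (2 * n.+1)%:R * (2 * (n%:R - k%:R) * cd_quot k n)); last by ring.
rewrite -IH.
by rewrite !(deriv_herm _ _.+1) /= !hermS; ring.
Qed.

Definition cd_series k : nat -> A := biseries mehler_wt (cd_quot k) herm.

Lemma cd_series_rec k : cd_series k.+1 = fun n =>
  inx (herm k) * E n + act 'X (fun m => 2 * Y * cd_series k m + (-1) * dy (cd_series k m)) n.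
Proof.
rewrite /cd_series -biseries_hermSy -biseries_shiftx; apply/funext => n.
by rewrite /biseries /= inxD !inxM /mehler_ps /biseries; ring.
Qed.

Lemma dy_cd_series0 : (fun n => dy (cd_series 0 n)) = act 'X E.
Proof.
rewrite /cd_series dy_biseries.
have -> : (fun n => (herm n)^`()) = (fun n => (2 * n)%:R * herm n.-1).
  by apply/funext => n; rewrite deriv_herm.
by rewrite biseries_shifty.
Qed.

Lemma dy_actXn_cd_series0 k n :
  dy (act 'X^k (cd_series 0) n) = act 'X^k (act 'X E) n.
Proof.
have /(congr1 (fun h => h n)) /= -> :=
  derivation_actXn k (cd_series 0) (derivation_dy F).
by rewrite dy_cd_series0.
Qed.

(** What is left of [cd_series k] once the multiple z^k H_k(y) of
    [cd_series 0] is taken out; see [cd_seriesE].  The recurrence is that of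
    [cd_series], where (2y - d_y) (H_k U_0) = H_(k+1) U_0 - H_k d_y U_0 and
    d_y U_0 = z E. *)
Fixpoint cd_rat (k : nat) : nat -> A :=
  if k is j.+1 then fun n => (inx (herm j) * E n + (- iny (herm j)) * act 'X^(j.+2) E n)
    + act 'X (fun m => 2 * Y * cd_rat j m + (-1) * dy (cd_rat j m)) n
  else fun _ => 0.

Lemma cd_seriesE k : cd_series k = fun n => iny (herm k) * act 'X^k (cd_series 0) n + cd_rat k n.
Proof.
elim: k => [|k IH].
  by apply/funext => n; rewrite expr0 act1 /iny rmorph1 mul1r addr0.
rewrite cd_series_rec IH; apply/funext => n /=.
have -> : (fun m => 2 * Y * (iny (herm k) * act 'X^k (cd_series 0) m + cd_rat k m) +
    (-1) * dy (iny (herm k) * act 'X^k (cd_series 0) m + cd_rat k m)) =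
  fun m => (iny (herm k.+1) * act 'X^k (cd_series 0) m + (- iny (herm k)) * act 'X^k (act 'X E) m)
    + (2 * Y * cd_rat k m + (-1) * dy (cd_rat k m)).
  apply/funext => m; rewrite !(derivation_dy F).1 (derivation_dy F).2.
  rewrite dy_actXn_cd_series0.
  by rewrite dy_iny hermS inyB !inyM inyn; ring.
rewrite !act_addr !act_scaler -(act_mul 'X 'X^k (cd_series 0)) -(act_mul 'X 'X^k).
rewrite -exprS -act_mul -exprSr.
ring.
Qed.

Lemma rat_mehler_actXn d (f : nat -> A) k : rat_mehler 0 d f -> rat_mehler 0 (d + k) (act 'X^k f).
Proof.
elim: k => [|k IH] Hf; first by rewrite addn0 expr0 act1.
by rewrite addnS exprS act_mul; apply/rat_mult_mulX/IH.
Qed.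

Lemma rat_mehler_cd_rat k : exists N, rat_mehler N k.+1 (cd_rat k).
Proof.
elim: k => [|k [N IH]].
  exists 0%N; exists 0; rewrite ?size_poly0 //; apply/funext => n.
  by rewrite /act !big1 // => i _; rewrite ?mulr0 // coef0 mul0r.
exists N.+1; apply: rat_mult_add; first apply: rat_mult_add.
- apply: rat_mult_scale; apply: (@rat_mult_le _ _ 0 0) => //; exact: rat_mult_self.
- apply: rat_mult_scale; apply: (@rat_mult_le _ _ 0 k.+2) => //.
  by have := rat_mehler_actXn k.+2 (rat_mult_self E); rewrite add0n.
- apply/rat_mult_mulX/rat_mult_add; apply: rat_mult_scale; last exact: rat_mehler_dy.
  exact: rat_mult_raise.
Qed.

(** Wr_y[H_k, f H_k] = H_k^2 d_y f, so in the Wronskian of [cd_series k] with H_k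
    the series [cd_series 0], which is no rational multiple of the Mehler series,
    enters only through its derivative z E. *)
Lemma rat_mehler_one_index k : exists N,
  rat_mehler N k.+1 (biseries (fun n => mehler_wt n / (n%:R - k%:R))
    (fun n => wr (herm k) (herm n)) (fun n => wr (herm k) (herm n))).
Proof.
have [N rT] := rat_mehler_cd_rat k; exists N.+1.
set h := herm k.
have -> : biseries (fun n => mehler_wt n / (n%:R - k%:R))
    (fun n => wr h (herm n)) (fun n => wr h (herm n)) =
  fun n => 2 * (iny (h ^+ 2) * act 'X^(k.+1) E n +
    (iny h * dy (cd_rat k n) + (- iny h^`()) * cd_rat k n)).
  apply/funext => n.
  have -> : 2 * (iny (h ^+ 2) * act 'X^(k.+1) E n +
      (iny h * dy (cd_rat k n) + (- iny h^`()) * cd_rat k n))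
    = 2 * (iny h * dy (cd_series k n) - iny h^`() * cd_series k n).
    rewrite cd_seriesE (derivation_dy F).1 (derivation_dy F).2.
    rewrite dy_actXn_cd_series0.
    rewrite -act_mul -exprSr dy_iny inyM -/h; ring.
  have /(congr1 (fun h => h n)) /= -> := dy_biseries mehler_wt (cd_quot k) herm.
  rewrite /cd_series /biseries.
  have -> : 2 * (iny h * (inx (cd_quot k n) * iny (herm n)^`() * scal (mehler_wt n)) -
      iny h^`() * (inx (cd_quot k n) * iny (herm n) * scal (mehler_wt n))) =
      2 * inx (cd_quot k n) * iny (wr h (herm n)) * scal (mehler_wt n).
    by rewrite /wr inyB !inyM; ring.
  (* At n = k the quotient by n - k is 0 by convention, and the right-hand side
     vanishes because Wr[h, h] = 0. *)
  have [->|nk] := eqVneq n k.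
    by rewrite /h (_ : wr _ _ = 0) ?iny0 ?mulr0 ?mul0r // /wr mulrC subrr.
  rewrite (congr1 (@inx F) (wr_cd_quot k n)) !inxM inxB !inxn !scalM.
  have nz : n%:R - k%:R != 0 :> F by rewrite subr_eq0 eqr_nat.
  have e1 : (n%:R - k%:R) * scal (n%:R - k%:R : F)^-1 = 1.
    transitivity (scal ((n%:R - k%:R) / (n%:R - k%:R) : F)); first by rewrite scalM scalB !scaln.
    by rewrite divff // /scal !rmorph1.
  transitivity (2 * inx (cd_quot k n) * iny (wr h (herm n)) * scal (mehler_wt n) *
      ((n%:R - k%:R) * scal (n%:R - k%:R : F)^-1)).
    by ring.
  by rewrite e1 mulr1.
apply: rat_mult_scale; apply: rat_mult_add.
  apply: rat_mult_scale; apply: (@rat_mult_le _ _ 0 k.+1) => //.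
  by have := rat_mehler_actXn k.+1 (rat_mult_self E); rewrite add0n.
apply: rat_mult_add; apply: rat_mult_scale; first exact: rat_mehler_dy.
exact: rat_mult_raise.
Qed.
End OneIndex.

(** * Differential operators and Wronskians *)
Section Operators.
Variable F : numFieldType.
Implicit Types (p q h : {poly F}).

(** [n] bounds the order strictly. *)
Definition diffop (n : nat) (G : {poly F} -> {poly F}) :=
  exists e : nat -> {poly F}, forall q, G q = \sum_(i < n) e i * q^`(i).

Lemma diffop_ext n G G' : G =1 G' -> diffop n G -> diffop n G'.
Proof. by move=> eG [e He]; exists e => q; rewrite -eG. Qed.

Lemma diffop_le m n G : (m <= n)%N -> diffop m G -> diffop n G.
Proof.
move=> mn [e He]; exists (fun i => if (i < m)%N then e i else 0) => q.
rewrite He (big_ord_widen n (fun i => e i * q^`(i)) mn) big_mkcond.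
by apply: eq_bigr => i _; case: ifP => // _; rewrite mul0r.
Qed.

Lemma diffop_add n G G' : diffop n G -> diffop n G' -> diffop n (fun q => G q + G' q).
Proof.
move=> [e He] [e' He']; exists (fun i => e i + e' i) => q.
by rewrite He He' -big_split; apply: eq_bigr => i _; rewrite mulrDl.
Qed.

Lemma diffop_mul n p G : diffop n G -> diffop n (fun q => p * G q).
Proof.
move=> [e He]; exists (fun i => p * e i) => q.
by rewrite He mulr_sumr; apply: eq_bigr => i _; rewrite mulrA.
Qed.

Lemma diffop_term n i p : (i < n)%N -> diffop n (fun q => p * q^`(i)).
Proof.
move=> ni; exists (fun j => if j == i then p else 0) => q.
rewrite (bigD1 (Ordinal ni)) //= eqxx big1 ?addr0 // => j ji.
by rewrite ifF ?mul0r //; apply/negbTE.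
Qed.

Lemma diffop_sum n m (e : nat -> {poly F}) (k : nat -> nat) :
  (forall i, (i < m)%N -> (k i < n)%N) ->
  diffop n (fun q => \sum_(i < m) e i * q^`(k i)).
Proof.
elim: m => [|m IH] km.
  by exists (fun _ => 0) => q; rewrite big_ord0 big1 // => i _; rewrite mul0r.
apply: (@diffop_ext _ (fun q => \sum_(i < m) e i * q^`(k i) + e m * q^`(k m))).
  by move=> q; rewrite big_ord_recr.
apply: diffop_add; first by apply: IH => i im; apply: km; rewrite ltnS ltnW.
by apply/diffop_term/km.
Qed.

Lemma diffop_deriv n G : diffop n G -> diffop n.+1 (fun q => (G q)^`()).
Proof.
move=> [e He]; apply: (@diffop_ext _ (fun q =>
  \sum_(i < n) (e i)^`() * q^`(i) + \sum_(i < n) e i * q^`(i.+1))).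
  move=> q; rewrite He raddf_sum -big_split; apply: eq_bigr => i _.
  by rewrite /= derivM.
apply: diffop_add; last exact: (@diffop_sum _ _ e S).
by apply: (@diffop_sum _ _ (fun i => (e i)^`()) id) => i; apply: ltnW.
Qed.

Lemma wr_derivn h l : diffop l.+1 (fun q => (wr h q)^`(l) - h * q^`(l.+1)).
Proof.
elim: l => [|l IH].
  apply: (@diffop_ext _ (fun q => (- h^`()) * q^`(0))); last exact: diffop_term.
  by move=> q; rewrite !derivn0 derivn1 /wr; ring.
apply: (@diffop_ext _ (fun q => ((wr h q)^`(l) - h * q^`(l.+1))^`() + h^`() * q^`(l.+1))).
  by move=> q; rewrite derivB derivM -!derivnS; ring.
by apply: diffop_add; [apply: diffop_deriv | apply: diffop_term].
Qed.

(** Right division by f |-> Wr[h, f]: the leading term of [h * G] is removed by a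
    multiple of a derivative of Wr[h, f], and the remainder, of lower order, still
    kills [h].  A remainder of order zero killing [h] is zero. *)
Lemma diffop_factor h l G : h != 0 -> diffop l.+1 G -> G h = 0 ->
  exists2 B, diffop l B & forall q, h ^+ l * G q = B (wr h q).
Proof.
move=> h0; elim: l G => [|l IH] G [a Ha] Gh.
  exists (fun _ => 0); first by exists (fun _ => 0) => q; rewrite big_ord0.
  have a0 : a 0%N = 0.
    apply/eqP; move/eqP: Gh; rewrite Ha big_ord1 derivn0 mulf_eq0 (negPf h0).
    by rewrite orbF.
  by move=> q; rewrite Ha big_ord1 a0 mul0r mulr0.
pose G' q := h * G q - a l.+1 * (wr h q)^`(l).
have whh : wr h h = 0 by rewrite /wr mulrC subrr.
have [||B dB HB] := IH G'.
- apply: (@diffop_ext _ (fun q => h * (\sum_(i < l.+1) a i * q^`(i))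
     + (- a l.+1) * ((wr h q)^`(l) - h * q^`(l.+1)))).
    by move=> q; rewrite /G' Ha [in RHS]big_ord_recr /=; ring.
  apply: diffop_add; apply: diffop_mul; last exact: wr_derivn.
  by exists a.
- by rewrite /G' Gh whh raddf0 !mulr0 subrr.
exists (fun q => h ^+ l * a l.+1 * q^`(l) + B q).
  apply: diffop_add; first exact: diffop_term.
  exact: diffop_le dB.
by move=> q; rewrite -HB /G' exprS; ring.
Qed.

Lemma wronskianE n (f : seq {poly F}) : size f = n ->
  wronskian f = \det (\matrix_(i < n, j < n) derivn i f`_j).
Proof. by move=> <-. Qed.

Lemma wronskian_diffop (r : seq {poly F}) :
  diffop (size r).+1 (fun g => wronskian (rcons r g)).
Proof.
set n := size r.
pose M g := \matrix_(i < n.+1, j < n.+1) derivn i (rcons r g)`_j.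
exists (fun i => cofactor (M 0) (inord i) ord_max) => g.
rewrite (@wronskianE n.+1) ?size_rcons // (expand_det_col _ ord_max).
apply: eq_bigr => i _; rewrite mulrC mxE nth_rcons /= ltnn eqxx inord_val.
congr (_ * _); rewrite /cofactor; congr (_ * \det _); apply/matrixP => a b.
rewrite !mxE !nth_rcons (_ : (lift ord_max b < size r)%N) //.
by rewrite lift_max; apply: ltn_ord.
Qed.

Lemma wronskian_mem (r : seq {poly F}) h : h \in r -> wronskian (rcons r h) = 0.
Proof.
move=> hr; set n := size r.
rewrite (@wronskianE n.+1) ?size_rcons // -det_tr.
have hi : (index h r < n)%N by rewrite index_mem.
apply: (@determinant_alternate _ _ _ (widen_ord (leqnSn n) (Ordinal hi)) ord_max).
  by rewrite -val_eqE /= neq_ltn hi.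
by move=> j; rewrite !mxE !nth_rcons /= hi ltnn eqxx nth_index.
Qed.

End Operators.

(** * Partial fractions *)
Section PartialFractions.
Variable F : fieldType.

(** A further factor t - a is absorbed by
    1 / ((t - d) (t - a)) = (1 / (t - d) - 1 / (t - a)) / (d - a). *)
Lemma partial_fractions (r : seq F) : uniq r -> (0 < size r)%N ->
  exists c : F -> F, forall t, t \notin r ->
    (\prod_(b <- r) (t - b))^-1 = \sum_(b <- r) c b / (t - b).
Proof.
elim: r => // a r IH /= /andP[ar ur] _.
case: r IH ar ur => [|b r] IH ar ur.
  by exists (fun _ => 1) => t _; rewrite !big_seq1 mul1r.
have [//|//|c Hc] := IH.
pose S := \sum_(d <- b :: r) c d / (a - d).
exists (fun d => if d == a then S else c d / (d - a)) => t.
rewrite inE negb_or => /andP[ta tr].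
rewrite big_cons invfM Hc // [RHS]big_cons eqxx mulr_sumr /S mulr_suml -big_split.
rewrite [LHS]big_seq_cond [RHS]big_seq_cond.
apply: eq_bigr => d; rewrite andbT => dr.
have da : d != a by apply: contraNneq ar => <-.
rewrite (negPf da) /=.
have h1 : t - a != 0 by rewrite subr_eq0.
have h2 : t - d != 0 by rewrite subr_eq0; apply: contraNneq tr => ->.
have h3 : a - d != 0 by rewrite subr_eq0 eq_sym.
have h4 : d - a != 0 by rewrite subr_eq0.
by field; rewrite h1 h2 h3 h4.
Qed.

End PartialFractions.

(** * Division of power series *)
Section Quotient.
Variable A : idomainType.
Implicit Types (P Q : {poly A}) (H : A) (E f : nat -> A).

Lemma quotient_upto E f m : E 0%N = 1 ->
  exists2 Q : {poly A}, (size Q <= m)%N & forall i, (i < m)%N -> act Q E i = f i.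
Proof.
move=> E0; elim: m => [|m [Q sQ HQ]]; first by exists 0; rewrite ?size_poly0.
exists (Q + (f m - act Q E m) *: 'X^m).
  rewrite (leq_trans (size_polyD _ _)) // geq_max (leq_trans sQ) //.
  by rewrite (leq_trans (size_scale_leq _ _)) // size_polyXn.
have Xm : forall i, (i <= m)%N -> act 'X^m E i = (i == m)%:R.
  move=> i im; rewrite /act big_ord_recr /= big1 ?add0r ?coefXn ?subnn ?E0 ?mulr1 //.
  by move=> j _; rewrite coefXn ltn_eqF ?mul0r // (leq_trans (ltn_ord j)).
move=> i; rewrite ltnS => im; rewrite act_addl act_scalel Xm //.
move: im; rewrite leq_eqVlt; case: eqVneq => [-> _|_ /= im].
  by rewrite mulr1 addrC subrK.
by rewrite mulr0 addr0 HQ.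
Qed.

(** The truncated quotient of [f] by [E] agrees with [P / H] up to the degree of
    [P], hence everywhere: no division in the coefficient ring takes place. *)
Lemma quotient_poly E f H P m : E 0%N = 1 -> H != 0 -> (size P <= m)%N ->
  (fun n => H * f n) = act P E -> exists2 Q : {poly A}, (size Q <= m)%N & f = act Q E.
Proof.
move=> E0 H0 sP eP; have [Q sQ HQ] := quotient_upto f m E0; exists Q => //.
have PQ : P = H *: Q.
  apply/polyP => i; have [im|mi] := ltnP i m; last first.
    by rewrite !nth_default // ?(leq_trans _ mi) // (leq_trans (size_scale_leq _ _)).
  apply: (act_coef_inj E0 _ im) => j jm.
  by rewrite -eP act_scalel HQ.
by apply/funext => n; apply: (mulfI H0); have := congr1 (fun h => h n) eP; rewrite PQ act_scalel.
Qed.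

End Quotient.

(** * The exceptional series as a polynomial multiple of the Mehler series *)
Section Assembly.
Variable F : numFieldType.
Local Notation A := {poly {poly F}}.
Implicit Types (f : nat -> A) (H : A).
Local Notation E := (mehler_ps F).
Local Notation herm := (herm F).
Local Notation mehler_wt := (mehler_wt F).

Lemma rat_mehler_diffopx G m N d c a b :
  diffop m.+1 G -> rat_mehler N d (biseries c a b : nat -> A) ->
  rat_mehler (N + m) d (biseries c (fun n => G (a n)) b : nat -> A).
Proof.
move=> [e He] r.
have ri i : rat_mehler (N + i) d (biseries c (fun n => (a n)^`(i)) b : nat -> A).
  elim: i => [|i IH]; first by rewrite addn0.
  rewrite addnS (_ : biseries _ _ _ = fun n => dx (biseries c (fun n => (a n)^`(i)) b n)).
    exact: rat_mehler_dx.
  by rewrite dx_biseries.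
have -> : biseries c (fun n => G (a n)) b =
    fun n => \sum_(i < m.+1) inx (e i) * biseries c (fun n => (a n)^`(i)) b n :> A.
  apply/funext => n; rewrite /biseries He /inx rmorph_sum !mulr_suml; apply: eq_bigr => i _.
  by rewrite rmorphM !mulrA.
apply: rat_mult_sum => i; apply: rat_mult_scale; apply: rat_mult_le (ri i) => //.
by rewrite leq_add2l -ltnS.
Qed.

Lemma rat_mehler_diffopy G m N d c a b :
  diffop m.+1 G -> rat_mehler N d (biseries c a b : nat -> A) ->
  rat_mehler (N + m) d (biseries c a (fun n => G (b n)) : nat -> A).
Proof.
move=> [e He] r.
have ri i : rat_mehler (N + i) d (biseries c a (fun n => (b n)^`(i)) : nat -> A).
  elim: i => [|i IH]; first by rewrite addn0.
  rewrite addnS (_ : biseries _ _ _ = fun n => dy (biseries c a (fun n => (b n)^`(i)) n)).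
    exact: rat_mehler_dy.
  by rewrite dy_biseries.
have -> : biseries c a (fun n => G (b n)) =
    fun n => \sum_(i < m.+1) iny (e i) * biseries c a (fun n => (b n)^`(i)) n :> A.
  apply/funext => n; rewrite /biseries He /iny rmorph_sum mulr_sumr mulr_suml.
  apply: eq_bigr => i _.
  by rewrite rmorphM /=; ring.
apply: rat_mult_sum => i; apply: rat_mult_scale; apply: rat_mult_le (ri i) => //.
by rewrite leq_add2l -ltnS.
Qed.

(** Clearing denominators in x and y by [H] replaces working over rational
    functions of x and y. *)
Definition quasi_rat d f := exists2 H, H != 0 & exists N, rat_mehler N d (fun n => H * f n).

Lemma quasi_rat_add d f g : quasi_rat d f -> quasi_rat d g -> quasi_rat d (fun n => f n + g n).
Proof.
move=> [H H0 [N r]] [K K0 [M t]]; exists (H * K); first exact: mulf_neq0.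
exists (maxn N M).
rewrite (_ : (fun n => _) = fun n => K * (H * f n) + H * (K * g n)).
  apply: rat_mult_add; apply: rat_mult_scale.
    by apply: rat_mult_le r; rewrite ?leq_maxl.
  by apply: rat_mult_le t; rewrite ?leq_maxr.
by apply/funext => n; ring.
Qed.

Lemma quasi_rat_scale d c f : quasi_rat d f -> quasi_rat d (fun n => c * f n).
Proof.
move=> [H H0 [N r]]; exists H => //; exists N.
rewrite (_ : (fun n => _) = fun n => c * (H * f n)); first exact: rat_mult_scale.
by apply/funext => n; rewrite mulrCA.
Qed.

Lemma quasi_rat_le d d' f : (d <= d')%N -> quasi_rat d f -> quasi_rat d' f.
Proof. by move=> dd [H H0 [N r]]; exists H => //; exists N; apply: rat_mult_le r. Qed.

Lemma quasi_rat_sum d (I : eqType) (r : seq I) (f : I -> nat -> A) :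
  (forall i, i \in r -> quasi_rat d (f i)) ->
  quasi_rat d (fun n => \sum_(i <- r) f i n).
Proof.
elim: r => [|i r IH] Hr.
  exists 1; first exact: oner_neq0.
  exists 0%N; exists 0; rewrite ?size_poly0 //; apply/funext => n.
  by rewrite /act !big1 // => i _; rewrite ?big_nil ?mulr0 // coef0 mul0r.
rewrite (_ : (fun n => _) = fun n => f i n + \sum_(i <- r) f i n).
  apply: quasi_rat_add; first by apply: Hr; rewrite mem_head.
  by apply: IH => j jr; apply: Hr; rewrite inE jr orbT.
by apply/funext => n; rewrite big_cons.
Qed.

Lemma inx_neq0 p : p != 0 -> (inx p : A) != 0.
Proof. by apply: contra_neq => /eqP; rewrite map_polyC_eq0 => /eqP. Qed.

Lemma iny_neq0 p : p != 0 -> (iny p : A) != 0.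
Proof. by rewrite /iny polyC_eq0. Qed.

Section Exceptional.
Variable ks : seq nat.
Hypotheses (uks : uniq ks) (ks0 : (0 < size ks)%N).
Let l := size ks.

Definition exc_op (g : {poly F}) := wronskian (rcons (map herm ks) g).

Lemma exc_op_diffop : diffop l.+1 exc_op.
Proof. by have := wronskian_diffop (map herm ks); rewrite size_map. Qed.

Lemma exc_op_herm n : n \in ks -> exc_op (herm n) = 0.
Proof. by move=> nk; apply/wronskian_mem/map_f. Qed.

Definition exc_herm n := exc_op (herm n).

(** [diffop_factor] writes both exceptional polynomials as derivatives of
    Wr[H_k, H_n], up to powers of H_k; the operators that occur apply to the
    one-index series as a whole. *)
Lemma quasi_rat_term k : k \in ks ->
  quasi_rat k.+1 (biseries (fun n => mehler_wt n / (n%:R - k%:R)) exc_herm exc_herm).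
Proof.
move=> kk; set h := herm k; have h0 : h != 0 := herm_neq0 F k.
have [B dB HB] := diffop_factor h0 exc_op_diffop (exc_op_herm kk).
have [N r] := rat_mehler_one_index F k.
have dB' : diffop l.+1 B by apply: diffop_le dB.
exists (inx (h ^+ l) * iny (h ^+ l)).
  by rewrite mulf_neq0 ?inx_neq0 ?iny_neq0 // expf_neq0.
exists (N + l + l)%N.
have := rat_mehler_diffopy dB' (rat_mehler_diffopx dB' r).
congr rat_mehler; apply/funext => n; rewrite /biseries -!HB inxM inyM /exc_herm; ring.
Qed.

Definition exc_wt n : F := ((2 ^ (n + l) * n`!)%N%:R * \prod_(j <- ks) (n%:R - j%:R))^-1.

(** The terms with n in [ks] are 0, because the Wronskian has two equal
    columns. *)
Definition exc_ps : nat -> A := biseries exc_wt exc_herm exc_herm.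

Lemma exc_wt_prod n : n \notin ks ->
  \prod_(j <- ks) (n%:R - j%:R) * exc_wt n = (2 ^ l)%:R^-1 * mehler_wt n.
Proof.
move=> nk; rewrite /exc_wt invfM mulrCA divff.
  rewrite mulr1 /mehler_wt -invfM -natrM; congr (_%:R^-1).
  by rewrite mulnA -expnD addnC.
rewrite prodf_seq_neq0; apply/allP => j jk /=.
by rewrite subr_eq0 eqr_nat; apply: contraNneq nk => ->.
Qed.

Lemma quasi_rat_exc_ps d : (forall k, k \in ks -> (k <= d)%N) -> quasi_rat d.+1 exc_ps.
Proof.
move=> dk.
have injn : injective (fun j : nat => j%:R : F) by move=> i j /eqP; rewrite eqr_nat => /eqP.
have [||c Hc] := @partial_fractions F (map (fun j : nat => j%:R) ks).
- by rewrite map_inj_uniq.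
- by rewrite size_map.
have -> : exc_ps = fun n => \sum_(k <- ks) scal ((2 ^ l)%:R^-1 * c k%:R) *
    biseries (fun n => mehler_wt n / (n%:R - k%:R)) exc_herm exc_herm n.
  apply/funext => n; rewrite /exc_ps /biseries.
  have [nk|nk] := boolP (n \in ks).
    rewrite /exc_herm exc_op_herm // inx0 !mul0r big1 // => k _.
    by rewrite !mul0r mulr0.
  under eq_bigr => k _ do rewrite mulrCA -scalM.
  rewrite -mulr_sumr; congr (_ * _).
  rewrite /scal -!rmorph_sum /=; congr (_%:P%:P).
  have -> : exc_wt n = (2 ^ l)%:R^-1 * mehler_wt n * (\prod_(j <- ks) (n%:R - j%:R))^-1.
    by rewrite /exc_wt /mehler_wt addnC expnD -mulnA natrM !invfM.
  have := Hc n%:R; rewrite !big_map => ->; last first.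
    by apply/negP => /mapP[j jk /injn nj]; rewrite nj jk in nk.
  by rewrite mulr_sumr; apply: eq_bigr => k _; ring.
apply: quasi_rat_sum => k kk; apply: quasi_rat_scale.
by apply: quasi_rat_le (quasi_rat_term kk); rewrite ltnS dk.
Qed.

Lemma exc_ps_quotient d : (forall k, k \in ks -> (k <= d)%N) ->
  exists2 Q : {poly A}, (size Q <= d.+2)%N & exc_ps = act Q E.
Proof.
move=> dk; have [H H0 [N r]] := quasi_rat_exc_ps dk.
have [g1 gN1] := euler_coef_neq0 F.
have r0 : rat_mehler 0 d.+1 (fun n => H * exc_ps n).
  apply: (rat_mult_no_pole (mehler_ps0 F) (euler_mehler_ps F) g1 gN1 (two_neq0 F)
    (ks := map (fun j : nat => j%:R) ks) (d' := 0%N) r).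
  rewrite size_map [X in rat_mult _ _ _ X](_ : _ =
      fun n => H * scal ((2 ^ l)%:R^-1) * biseries mehler_wt exc_herm exc_herm n).
    apply: rat_mult_scale; rewrite -addnn.
    have := rat_mehler_diffopy exc_op_diffop (rat_mehler_diffopx exc_op_diffop (rat_mult_self E)).
    by rewrite add0n.
  apply/funext => n; rewrite big_map /exc_ps /biseries.
  have [nk|nk] := boolP (n \in ks).
    by rewrite /exc_herm exc_op_herm // inx0 !mul0r !mulr0.
  have e : \prod_(j <- ks) (n%:R - j%:R) * scal (exc_wt n) =
      scal ((2 ^ l)%:R^-1) * scal (mehler_wt n) :> A.
    rewrite -scalM -exc_wt_prod // scalM; congr (_ * _).
    rewrite /scal !rmorph_prod; apply: eq_bigr => j _.
    by rewrite !rmorphB !rmorph_nat.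
  transitivity (H * inx (exc_herm n) * iny (exc_herm n) *
      (\prod_(j <- ks) (n%:R - j%:R) * scal (exc_wt n))).
    by ring.
  by rewrite e; ring.
have [P sP eP] := r0; rewrite expr0 act1 addn0 in sP eP.
exact: (quotient_poly (mehler_ps0 F) H0 sP eP).
Qed.

End Exceptional.
End Assembly.

(** * Growth of Hermite polynomials *)
Section Growth.
Variable R : realType.

(** Normalised as a_n = b_n^2 / (2^n n!), the recurrence becomes
    a_(n+2) <= d a_(n+1) + (1 + d) a_n for large n, since the coefficient of
    a_(n+1) is O(1 / n); and (1 + 2d)^n is a supersolution of it. *)
Lemma hermite_growth (b : nat -> R) (xi d : R) : 0 < d -> 0 <= xi -> (forall n, 0 <= b n) ->
  (forall n, b n.+2 <= 2 * xi * b n.+1 + (2 * n.+1)%:R * b n) ->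
  exists M, forall n, b n ^+ 2 / (2 ^ n * n`!)%N%:R <= M * (1 + 2 * d) ^+ n.
Proof.
move=> d0 xi0 b0 brec.
pose w n : R := (2 ^ n * n`!)%N%:R.
pose a n : R := b n ^+ 2 / w n.
have wpos n : 0 < w n by rewrite ltr0n muln_gt0 expn_gt0 fact_gt0.
have wS n : w n.+1 = 2 * n.+1%:R * w n.
  by rewrite /w expnS factS !natrM; ring.
have a0 n : 0 <= a n by rewrite divr_ge0 ?sqr_ge0 // ltW.
have bE n : b n ^+ 2 = a n * w n by rewrite /a divfK // gt_eqF.
pose K := (1 + d^-1) * (2 * xi ^+ 2) / d.
have dV : 0 < d^-1 by rewrite invr_gt0.
have K0 : 0 <= K.
  by rewrite !mulr_ge0 ?sqr_ge0 // ?addr_ge0 // ltW.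
pose n0 := Num.bound K.
have Kn0 : K < n0%:R by apply: archi_boundP.
have arec n : (n0 <= n)%N -> a n.+2 <= d * a n.+1 + (1 + d) * a n.
  move=> nn.
  have Kn : (1 + d^-1) * (2 * xi ^+ 2) <= d * n.+2%:R.
    rewrite [leRHS]mulrC -ler_pdivrMr //; apply: ltW (lt_le_trans Kn0 _).
    by rewrite ler_nat (leq_trans nn) // -addn2 leq_addr.
  rewrite [a n.+2]/a ler_pdivrMr //.
  (* The factor of [v], which stands for the term in [b n], must be close to 1. *)
  have sq (u v : R) : (u + v) ^+ 2 <= (1 + d^-1) * u ^+ 2 + (1 + d) * v ^+ 2.
    have : 0 <= d^-1 * (u - d * v) ^+ 2 by rewrite mulr_ge0 ?sqr_ge0 // ltW.
    rewrite (_ : d^-1 * _ = d^-1 * u ^+ 2 - 2 * u * v + d * v ^+ 2); first by lra.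
    by field; rewrite gt_eqF.
  have := brec n; rewrite -(ler_pXn2r (n := 2)) ?nnegrE ?addr_ge0 ?mulr_ge0 //.
  move/le_trans; apply; apply: le_trans (sq _ _) _.
  rewrite !exprMn bE (bE n) -!/(a _) !wS natrM.
  have m0 : 0 < n.+1%:R :> R by rewrite ltr0n.
  have mS : n.+2%:R = n.+1%:R + 1 :> R by rewrite -natr1.
  rewrite mS in Kn *.
  move: (a0 n.+1) (a0 n) (wpos n) m0 Kn.
  move: (a n.+1) (a n) (w n) (n.+1%:R) (1 + d^-1) => a1 a2 w0 m e h1 h2 hw hm Kn.
  have t1 : 0 <= 4 * m * w0 * a1 * (d * (m + 1) - e * (2 * xi ^+ 2)).
    by rewrite mulr_ge0 ?subr_ge0 // !mulr_ge0 // ltW.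
  have t2 : 0 <= 4 * (1 + d) * m * w0 * a2.
    by rewrite !mulr_ge0 ?addr_ge0 // ltW.
  rewrite -subr_ge0.
  rewrite [X in 0 <= X](_ : _ = 4 * m * w0 * a1 * (d * (m + 1) - e * (2 * xi ^+ 2)) +
      4 * (1 + d) * m * w0 * a2); first exact: addr_ge0.
  by ring.
(* [M] bounds the terms that come before the recurrence is available. *)
pose M := \sum_(i < n0.+2) a i; exists M.
have M0 : 0 <= M by apply: sumr_ge0.
have q1 : 1 <= 1 + 2 * d by lra.
elim/ltn_ind => n IH; have [nn|] := ltnP n n0.+2.
  apply: (@le_trans _ _ M); last by rewrite ler_peMr // exprn_ege1.
  rewrite /M (bigD1 (Ordinal nn)) //= lerDl; exact: sumr_ge0.
case: n IH => [//|[//|n]] IH; rewrite !ltnS => nn.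
apply: le_trans (arec n nn) _.
have i1 := IH n.+1 (ltnSn _); have i2 := IH n (ltnW (ltnSn _)).
rewrite -/(w _) -/(a _) in i1 i2.
have p0 : 0 <= M * (1 + 2 * d) ^+ n by rewrite mulr_ge0 ?exprn_ge0 //; lra.
apply: (@le_trans _ _ (d * (M * (1 + 2 * d) ^+ n.+1) + (1 + d) * (M * (1 + 2 * d) ^+ n))).
  by apply: lerD; rewrite ler_pM2l //; lra.
rewrite !exprS; move: p0; move: (_ ^+ n) => p p0.
rewrite -subr_ge0 (_ : _ - _ = (M * p) * (2 * d + 2 * d ^+ 2)); last by ring.
by rewrite mulr_ge0 // addr_ge0 // !mulr_ge0 ?sqr_ge0 // ltW.
Qed.
End Growth.

(** * The series in terms of power series over polynomials *)
Section HermiteIdentification.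
Variable R : realType.

Lemma poly_ext (p q : {poly R}) : (forall x, p.[x] = q.[x]) -> p = q.
Proof.
move=> pq; apply/eqP; rewrite -subr_eq0; apply/eqP; apply: contraTeq isT => d0.
have := max_poly_roots (rs := [seq i%:R | i <- iota 0 (size (p - q))]) d0.
rewrite size_map size_iota ltnn; apply.
  by apply/allP => x _; rewrite /root !hornerE pq subrr.
rewrite map_inj_uniq ?iota_uniq // => i j /eqP.
by rewrite eqr_nat => /eqP.
Qed.

Lemma derive1n_gauss n (x : R) :
  derive1n n (fun t : R => expR (- t ^+ 2)) x =
  (-1) ^+ n * (herm R n).[x] * expR (- x ^+ 2).
Proof.
elim: n x => [|n IH] x; first by rewrite expr0 hornerC !mul1r.
rewrite derive1nS (_ : derive1n n _ = fun x => ((-1) ^+ n *: herm R n).[x] * expR (- x ^+ 2));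
  last by apply/funext => y; rewrite IH hornerZ.
have Hs : is_derive x (1 : R) (fun t : R => - t ^+ 2) (- (2%:R * x)).
  apply: is_deriveN; apply: is_derive_eq.
  by rewrite /GRing.scale/= mulr1 mulr_natl.
have He : is_derive x (1 : R) (fun t : R => expR (- t ^+ 2))
    (expR (- x ^+ 2) * - (2%:R * x)).
  exact: (is_derive1_comp (is_derive_expR _) Hs).
have Hm := is_deriveM (is_derive_poly ((-1) ^+ n *: herm R n) x) He.
rewrite derive1E (@derive_val _ _ _ _ _ _ _ Hm) hermS derivZ /GRing.scale/=.
rewrite !(hornerD, hornerN, hornerM, hornerX, hornerZ, hornerC) (exprS _ n).
ring.
Qed.

Lemma hermite_herm n : hermite R n = herm R n.
Proof.
apply: poly_ext => x; rewrite hermiteE /rodrigues derive1n_gauss expRN.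
have e0 : expR (x ^+ 2) != 0 by rewrite gt_eqF ?expR_gt0.
have s1 : (-1) ^+ n * (-1) ^+ n = 1 :> R by rewrite -exprMn mulrNN mulr1 expr1n.
rewrite [LHS](_ : _ = (-1) ^+ n * (-1) ^+ n * (herm R n).[x] * (expR (x ^+ 2) / expR (x ^+ 2))).
  by rewrite s1 divff // mul1r mulr1.
ring.
Qed.

Lemma cpoly_herm n : cpoly (hermite R n) = herm R[i] n.
Proof.
rewrite hermite_herm; elim: n => [|n IH]; first by rewrite /cpoly rmorph1.
rewrite !hermS -IH /cpoly rmorphB !rmorphM rmorph_nat /= map_polyX.
by rewrite deriv_map.
Qed.

Lemma cpoly_wronskian (f : seq {poly R}) :
  cpoly (wronskian f) = wronskian [seq cpoly p | p <- f].
Proof.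
rewrite (@wronskianE _ (size f) [seq cpoly p | p <- f]) ?size_map //.
rewrite /wronskian /cpoly -det_map_mx; congr (\det _); apply/matrixP => i j.
by rewrite !mxE (nth_map 0) // derivn_map.
Qed.

Lemma cpoly_exc_hermite (k : seq nat) n :
  cpoly (exc_hermite R k n) = exc_herm R[i] k n.
Proof.
rewrite /exc_hermite cpoly_wronskian map_rcons -map_comp cpoly_herm.
rewrite /exc_herm /exc_op; congr (wronskian (rcons _ _)).
by apply: eq_map => j /=; rewrite cpoly_herm.
Qed.

Definition ev2 (x y : R[i]) (P : {poly {poly R[i]}}) := (P.[x%:P]).[y].

Lemma ev2_biseries (x y : R[i]) c a b n :
  ev2 x y (biseries c a b n) = (a n).[x] * (b n).[y] * c n.
Proof.
rewrite /ev2 /biseries /inx /iny /scal !hornerM !hornerC.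
by rewrite horner_map /= !hornerC.
Qed.

Lemma mehler_termE (z x y : R[i]) n :
  mehler_term z x y n = z ^+ n * ev2 x y (mehler_ps R[i] n).
Proof. by rewrite ev2_biseries /mehler_term !cpoly_herm -mulrA. Qed.

Lemma exc_mehler_termE (k : seq nat) (z x y : R[i]) n :
  exc_mehler_term k z x y n = z ^+ n * ev2 x y (exc_ps R[i] k n).
Proof.
rewrite ev2_biseries /exc_mehler_term !cpoly_exc_hermite -mulrA.
by case: ifP => // nk; rewrite /exc_herm exc_op_herm // !horner0 !mul0r mulr0.
Qed.

End HermiteIdentification.

(** * Convergence and sums of the series *)
Section Convergence.
Variable R : realType.
Local Notation C := (R[i] : numFieldType).
Local Notation cabs := (@Normc.normc R).

Lemma cabs_ge0 (z : R[i]) : 0 <= cabs z.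
Proof. by case: z => a b; apply: sqrtr_ge0. Qed.

Lemma normC_cabs (z : R[i]) : `|z| = (cabs z)%:C.
Proof. by case: z. Qed.

Lemma cabs_natr n : cabs n%:R = n%:R.
Proof. by apply: complexI; rewrite -normC_cabs normr_nat rmorph_nat. Qed.

Lemma cabs_Re (z : R[i]) : `|complex.Re z| <= cabs z.
Proof. by have := normc_ge_Re z; rewrite normC_cabs lecR. Qed.

Lemma cabs_Im (z : R[i]) : `|complex.Im z| <= cabs z.
Proof.
have := cabs_Re ('i%C * z); case: z => a b /=.
rewrite !mul0r !mul1r sub0r normrN => /le_trans; apply.
by rewrite add0r sqrrN addrC.
Qed.

Lemma cvg_real_complex (u : nat -> R) (l : R) : (u n @[n --> \oo] --> l)%classic ->
  ((fun n => (u n)%:C : C) n @[n --> \oo] --> (l%:C : C))%classic.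
Proof.
move=> /cvgrPdist_lt ul; apply/cvgrPdist_lt => e e0.
have [e1 eE] : exists e1 : R, (e : R[i]) = e1%:C.
  exists (complex.Re e); apply/esym/eqP; rewrite eq_complex /= eqxx /=.
  by move: e0; rewrite ltcE /= => /andP[/eqP ->].
have e10 : 0 < e1 by rewrite -ltcR -eE.
near=> n.
rewrite -rmorphB /= normC_cabs eE ltcR /= expr0n addr0 sqrtr_sqr.
by near: n; apply: ul.
Unshelve. all: by end_near. Qed.

(** The real and imaginary parts are dominated by a geometric series. *)
Lemma csummable_dominated (u : nat -> R[i]) (M q : R) :
  0 <= q < 1 -> (forall n, cabs (u n) <= M * q ^+ n) -> csummable u.
Proof.
move=> /andP[q0 q1] uM.
have part (f : R[i] -> R) : (forall z, `|f z| <= cabs z) -> cvgn (series (fun n => f (u n))).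
  move=> fz; apply: normed_cvg; apply: (@series_le_cvg _ _ (geometric M q)) => [n|n|n|].
  - exact: normr_ge0.
  - by apply: le_trans (uM n); apply: cabs_ge0.
  - by apply: le_trans (fz _) (uM n).
  - by apply: is_cvg_geometric_series; rewrite ger0_norm.
have /cvg_ex[a ca] := part _ cabs_Re; have /cvg_ex[b cb] := part _ cabs_Im.
apply/cvg_ex; exists (a%:C + 'i%C * b%:C).
have -> : series (cseq u) = fun N => (series (fun n => complex.Re (u n)) N)%:C +
    'i%C * (series (fun n => complex.Im (u n)) N)%:C :> C.
  apply/funext => N; rewrite /series /= !rmorph_sum mulr_sumr -big_split.
  by apply: eq_bigr => i _; rewrite /cseq {1}[u i]complexE.
by apply: cvgD; [exact: cvg_real_complex | apply: cvgMr; exact: cvg_real_complex].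
Qed.

Lemma herm_growth (x : R[i]) (d : R) : 0 < d -> exists M, forall n,
  cabs (herm R[i] n).[x] ^+ 2 / (2 ^ n * n`!)%N%:R <= M * (1 + 2 * d) ^+ n.
Proof.
move=> d0; apply: (hermite_growth (xi := cabs x)) => // [|n|n]; try exact: cabs_ge0.
rewrite hermS deriv_herm -mulrA hornerD hornerN !hornerM hornerX /=.
apply: le_trans (le_normcD _ _) _.
rewrite normcN !Normc.normcM -polyC_natr hornerC cabs_natr -polyC_natr hornerC cabs_natr.
by rewrite mulrA.
Qed.

Lemma mehler_summable (z x y : R[i]) : `|z| < 1 -> csummable (mehler_term z x y).
Proof.
rewrite normC_cabs -[1](rmorph1 (real_complex R)) ltcR => z1.
have z0 := cabs_ge0 z; set r := cabs z in z0 z1.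
(* With this choice r (1 + 2d) = 1 - (1 - r)^2 < 1. *)
pose d := (1 - r) / 2.
have d0 : 0 < d by rewrite divr_gt0 ?subr_gt0.
have [Mx Hx] := herm_growth x d0; have [My Hy] := herm_growth y d0.
have q0 : 0 <= r * (1 + 2 * d) < 1.
  rewrite mulr_ge0 //=; last by lra.
  rewrite (_ : r * _ = 1 - (1 - r) ^+ 2); last by rewrite /d; field.
  by rewrite ltrBlDr ltrDl exprn_gt0 // subr_gt0.
apply: (csummable_dominated q0 (M := (Mx + My) / 2)) => n.
rewrite mehler_termE ev2_biseries.
have cX m : cabs (z ^+ m) = r ^+ m.
  elim: m => [|m IH]; first by rewrite !expr0 Normc.normc1.
  by rewrite !exprS Normc.normcM IH.
rewrite !Normc.normcM cX Normc.normcV cabs_natr.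
have := Hx n; have := Hy n.
have := cabs_ge0 (herm R[i] n).[x]; have := cabs_ge0 (herm R[i] n).[y].
have w0 : 0 <= ((2 ^ n * n`!)%N%:R : R)^-1 by rewrite invr_ge0 ler0n.
move: w0 (cabs _.[x]) (cabs _.[y]) => w0 a b b0 a0 hy hx.
rewrite exprMn [leRHS]mulrCA; apply: ler_wpM2l; first exact: exprn_ge0.
move: w0 hx hy; set w := (_ %:R)^-1; set Q := _ ^+ n => w0 hx hy.
apply: (@le_trans _ _ ((a ^+ 2 * w + b ^+ 2 * w) / 2)); last by lra.
rewrite ler_pdivlMr // -subr_ge0 (_ : _ - _ = (a - b) ^+ 2 * w); last by ring.
by rewrite mulr_ge0 ?sqr_ge0.
Qed.

(** The partial sums of [t] are combinations, with the fixed weights [w], of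
    shifted partial sums of [m]; shifts do not change the limit. *)
Lemma series_act (m t w : nat -> R[i]) (D : nat) :
  (forall n, t n = \sum_(i < n.+1) w i * m (n - i)%N) ->
  (forall i, (D <= i)%N -> w i = 0) ->
  csummable m ->
  csummable t /\ csum t = csum m * \sum_(i < D) w i.
Proof.
move=> tE w0 cm.
have sE : series (cseq t) = fun N => \sum_(i < D) w i * series (cseq m) (N - i)%N :> C.
  apply/funext; elim=> [|N IH].
    by rewrite /series /= big_geq // big1 // => i _; rewrite big_geq ?mulr0.
  rewrite seriesSr IH.
  have -> : cseq t N = \sum_(i < D) (if (i <= N)%N then w i * m (N - i)%N else 0).
    rewrite /cseq tE.
    transitivity (\sum_(0 <= i < N.+1 + D) if (i <= N)%N then w i * m (N - i)%N else 0).
      rewrite (big_cat_nat (n := N.+1)) ?leq_addr //= [X in _ + X]big1_seq ?addr0.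
        rewrite big_mkord; apply: eq_bigr => i _; by rewrite -ltnS ltn_ord.
      by move=> i /=; rewrite mem_index_iota => /andP[Ni _]; rewrite leqNgt Ni.
    rewrite (big_cat_nat (n := D)) ?leq_addl //= [X in _ + X]big1_seq ?addr0 ?big_mkord //.
    move=> i /=; rewrite mem_index_iota => /andP[Di _].
    by rewrite w0 // mul0r if_same.
  rewrite -big_split; apply: eq_bigr => i _ /=.
  case: leqP => iN; last first.
    by rewrite addr0; move: iN (ltnW iN); rewrite -!subn_eq0 => /eqP -> /eqP ->.
  by rewrite subSn // seriesSr mulrDr.
have cv : (series (cseq t) N @[N --> \oo] --> (csum m * \sum_(i < D) w i : C))%classic.
  rewrite sE mulr_sumr.
  have lim : forall D', ((fun N => \sum_(i < D') w i * series (cseq m) (N - i)%N : C) N @[N --> \oo]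
     --> (\sum_(i < D') csum m * w i : C))%classic.
    elim=> [|D' IH].
      by under eq_fun do rewrite big_ord0; rewrite big_ord0; apply: cvg_cst.
    rewrite big_ord_recr /=.
    have -> : (fun N => \sum_(i < D'.+1) w i * series (cseq m) (N - i)%N : C) =
      (fun N => (\sum_(i < D') w i * series (cseq m) (N - i)%N : C) +
        w D' * series (cseq m) (N - D')%N).
      by apply/funext => N; rewrite big_ord_recr.
    apply: (cvgD IH); rewrite mulrC; apply: cvgMr.
    by have := cm; rewrite /csummable -(cvg_centern D').
  exact: lim D.
split; first by apply/cvg_ex; eexists; exact: cv.
exact: cvg_lim cv.
Qed.

End Convergence.

Lemma leq_last (r : seq nat) j : sorted ltn r -> j \in r -> (j <= last 0 r)%N.
Proof.
rewrite ltn_sorted_uniq_leq => /andP[_ sr] jr.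
have r0 : (0 < size r)%N by case: r jr {sr}.
have jlt : (index j r < size r)%N by rewrite index_mem.
rewrite -{1}(nth_index 0%N jr) -nth_last.
by apply: (sorted_leq_nth leq_trans leqnn) => //; rewrite ?inE ?prednK // -ltnS prednK.
Qed.

Theorem theorem1 (R : realType) (l : nat) (k : l.-tuple nat)
    (hl : (0 < l)%N) (kpos : forall j : nat, j \in k -> (0 < j)%N)
    (kincr : sorted ltn k) :
  exists Q : 'I_(last 0%N k + 2) -> {poly {poly R[i]}},
    forall z x y : R[i], `|z| < 1 ->
      [/\ csummable (mehler_term z x y),
          csummable (exc_mehler_term k z x y) &
          exc_mehler k z x y =
            mehler z x y *
            \sum_(n < last 0%N k + 2) z ^+ n * ((Q n).[x%:P]).[y]].
Proof.
have klast j (jk : j \in tval k) := leq_last kincr jk.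
have uk : uniq k := sorted_uniq ltn_trans ltnn kincr.
have sk : (0 < size k)%N by rewrite size_tuple.
have [Q sQ eQ] := @exc_ps_quotient R[i] k uk sk _ klast.
exists (fun n => Q`_n) => z x y z1.
have cm := @mehler_summable R z x y z1.
have [|i Di|ct eqs] := @series_act R (mehler_term z x y) (exc_mehler_term k z x y)
    (fun i => z ^+ i * ev2 x y Q`_i) (last 0%N k + 2) _ _ cm.
- move=> n; rewrite exc_mehler_termE eQ /act /ev2 !horner_sum mulr_sumr.
  apply: eq_bigr => i _; rewrite mehler_termE /ev2 !hornerM.
  rewrite -{1}(subnKC (ltn_ord i : (i <= n)%N)) exprD; ring.
- by rewrite addn2 in Di; rewrite nth_default ?(leq_trans sQ) // /ev2 !horner0 mulr0.
by split.
Qed.
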